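(* Let $d\geq 1$, let $G$ be a graph and let $G^v$ be its cone graph. Then $G^v$ is $M$-connected in $\mathbb{R}^{d+1}$ if and only if $G$ is connected and has no $M$-bridges in $\mathbb{R}^d$.
   Context: The cone $G^v$ of $G=(V,E)$ is obtained by adding a new vertex $v$ and all edges $uv$, $u\in V$. For $p:V\to\mathbb{R}^k$ the rigidity matrix has, for each edge $uw$, a row with $p(u)-p(w)$ in the columns of $u$, $p(w)-p(u)$ in those of $w$, zeros elsewhere; the rigidity matroid $\mathcal{R}_k(G)$ on $E$ is given by row independence for generic $p$ (coordinates algebraically independent over $\mathbb{Q}$), with rank function $r_k$. $G$ is $M$-connected in $\mathbb{R}^k$ if $\mathcal{R}_k(G)$ is connected (any two distinct edges lie in a common circuit). An edge $e$ is an $M$-bridge in $\mathbb{R}^k$ if $r_k(G-e)=r_k(G)-1$. *)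

(* Defs.v *)
From HB Require Import structures.
From mathcomp Require Import all_boot all_order all_algebra.
From mathcomp Require Import boolp reals.
From mathcomp Require Import mpoly.

Set Implicit Arguments.
Unset Strict Implicit.
Unset Printing Implicit Defensive.

Import GRing.Theory Num.Theory.
Local Open Scope ring_scope.

Definition simple_graph (V : finType) (E : {set {set V}}) : Prop :=
  forall e, e \in E -> #|e| = 2%N.

Definition adj (V : finType) (E : {set {set V}}) : rel V :=
  fun x y => (x != y) && ([set x; y] \in E).

Definition graph_connected (V : finType) (E : {set {set V}}) : Prop :=
  forall x y : V, connect (adj E) x y.

Definition cone_edges (V : finType) (E : {set {set V}}) : {set {set option V}} :=
  ((fun e : {set V} => (@Some V) @: e) @: E) :|: [set [set None; Some u] | u : V].

Definition coords (R : realType) (V : finType) (k : nat) (p : V -> 'rV[R]_k)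
  : 'I_#|{: V * 'I_k}| -> R :=
  fun i => let vj := enum_val i in p vj.1 0 vj.2.

Definition generic (R : realType) (V : finType) (k : nat) (p : V -> 'rV[R]_k)
  : Prop :=
  forall q : mpoly.mpoly #|{: V * 'I_k}| rat,
    q != 0 -> mpoly.meval (coords p) (mpoly.map_mpoly (@ratr R) q) != 0.

(* Row of the rigidity matrix for an edge e = {u, w}: p(u)-p(w) in the
   columns of u, p(w)-p(u) in those of w, zero elsewhere.  For x in e,
   \sum_(y in e) (p x - p y) = p x - p (other endpoint). *)
Definition rig_row (R : realType) (V : finType) (k : nat) (p : V -> 'rV[R]_k)
  (e : {set V}) : {ffun V -> 'rV[R]_k} :=
  [ffun x => if x \in e then \sum_(y in e) (p x - p y) else 0].

Definition rig_indep (R : realType) (V : finType) (k : nat) (F : {set {set V}})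
  : Prop :=
  forall p : V -> 'rV[R]_k, generic p -> free (map (rig_row p) (enum F)).

Definition rig_rank (R : realType) (V : finType) (k : nat) (F : {set {set V}})
  : nat :=
  (\max_(S : {set {set V}} | (S \subset F) && `[< rig_indep R k S >]) #|S|)%N.

Definition rig_circuit (R : realType) (V : finType) (k : nat)
  (E C : {set {set V}}) : Prop :=
  C \subset E /\ ~ rig_indep R k C /\
  (forall D : {set {set V}}, D \proper C -> rig_indep R k D).

Definition M_connected (R : realType) (V : finType) (k : nat)
  (E : {set {set V}}) : Prop :=
  forall e f, e \in E -> f \in E -> e != f ->
    exists C, rig_circuit R k E C /\ e \in C /\ f \in C.

Definition M_bridge (R : realType) (V : finType) (k : nat)
  (E : {set {set V}}) (e : {set V}) : Prop :=
  e \in E /\ rig_rank R k (E :\ e) = (rig_rank R k E).-1.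

(* Main.v *)
Require Import Defs.
From HB Require Import structures.
From mathcomp Require Import all_boot all_order all_algebra.
From mathcomp Require Import boolp reals polyrcf.
From mathcomp Require Import mpoly.
From mathcomp Require classical_sets.

(** Equilibrium stresses of a framework [p] in dimension [d] correspond bijectively to
    equilibrium stresses of a cone framework in dimension [d + 1] with the cone point at
    the origin and [q u = l u *: (1, p u)]: on old edges [uw] the stress is divided by
    [l u * l w], and on the edge to the cone point the stress is then determined.  Hence
    coning preserves independence and dependence.  If [C] is a circuit in dimension [d],
    its stress space is a line, and for suitable heights [l] the induced stress vanishes on
    no cone edge at the vertices of [C]; so the cone over [C] is again a circuit.  When [G]
    has no bridges every edge lies in such a circuit, and when [G] is connected these
    circuits chain all cone edges together.  Conversely, a stress of the cone restricts
    to the part above a component of [G], since the forces at the cone point cancel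
    automatically; and a bridge of [G] stays a bridge in the cone. *)

Set Implicit Arguments.
Unset Strict Implicit.
Unset Printing Implicit Defensive.

Import Order.TTheory GRing.Theory Num.Theory.
Local Open Scope ring_scope.

(** * Existence of generic points *)

Section NestedIntervals.
Variables (R : realType) (c : nat -> R).

(** In the second case the left quarter is kept rather than the left half, so that the new right end
    lies strictly below [x] even when [x] is the midpoint. *)
Definition avoid_step (x : R) (ab : R * R) : R * R :=
  let m := (ab.1 + ab.2) / 2 in
  if x < m then (m, ab.2) else (ab.1, (ab.1 + m) / 2).

Fixpoint avoid_seq (n : nat) : R * R :=
  if n is n'.+1 then avoid_step (c n') (avoid_seq n') else (0, 1).

Lemma avoid_stepP x ab : ab.1 < ab.2 ->
  [/\ (avoid_step x ab).1 < (avoid_step x ab).2,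
      ab.1 <= (avoid_step x ab).1, (avoid_step x ab).2 <= ab.2 &
      (x < (avoid_step x ab).1) || ((avoid_step x ab).2 < x)].
Proof.
case: ab => a b /= ab; rewrite /avoid_step /=.
have [am mb] := midf_lt ab; set m := (a + b) / 2 in am mb *.
have [am' m'm] := midf_lt am.
case: (ltP x m) => h /=; split => //; first exact: ltW.
- by rewrite h.
- exact/ltW/(lt_trans m'm).
- by rewrite (lt_le_trans m'm h) orbT.
Qed.

Lemma avoid_seq_lt n : (avoid_seq n).1 < (avoid_seq n).2.
Proof. by elim: n => [|n /(avoid_stepP (c n)) []] //=; rewrite ltr01. Qed.

Lemma avoid_seq_mono n k :
  (avoid_seq n).1 <= (avoid_seq (n + k)).1 /\
  (avoid_seq (n + k)).2 <= (avoid_seq n).2.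
Proof.
elim: k => [|k [IH1 IH2]]; first by rewrite addn0.
rewrite addnS /=.
have [_ h1 h2 _] := avoid_stepP (c (n + k)) (avoid_seq_lt (n + k)).
by split; [exact: le_trans h1 | exact: le_trans IH2].
Qed.

Lemma avoid_seq_cross n m : (avoid_seq n).1 <= (avoid_seq m).2.
Proof.
have [h1 _] := avoid_seq_mono n m; have [_ h2] := avoid_seq_mono m n.
by apply: le_trans h1 (le_trans (ltW (avoid_seq_lt _)) _); rewrite addnC.
Qed.

(** Cantor's nested intervals: the supremum of the left ends lies in every closed interval, and the
    interval at stage [n.+1] excludes [c n]. *)
Lemma real_avoid_seq : exists t : R, forall n, t != c n.
Proof.
pose A : classical_sets.set R := fun x => exists n, x = (avoid_seq n).1.
have supA : classical_sets.has_sup A.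
  split; first by exists (avoid_seq 0).1, 0%N.
  by exists (avoid_seq 0).2 => _ [n ->]; exact: avoid_seq_cross.
exists (sup A) => n; apply/eqP => tcn.
have h1 : (avoid_seq n.+1).1 <= sup A.
  by apply: sup_upper_bound => //; exists n.+1.
have h2 : sup A <= (avoid_seq n.+1).2.
  by apply: ge_sup => [|_ [m ->]]; [exists (avoid_seq 0).1, 0%N | exact: avoid_seq_cross].
have [_ _ _] := avoid_stepP (c n) (avoid_seq_lt n).
by rewrite !ltNge -tcn; move: h1 h2; rewrite /= -tcn => -> ->.
Qed.

End NestedIntervals.

Lemma poly_avoid (R : realType) (q : nat -> {poly R}) :
  (forall j, q j != 0) -> exists t : R, forall j, ~~ root (q j) t.
Proof.
move=> q0.
(* One sequence lists the real roots of all [q j], indexed by codes of pairs; the default value 0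
   elsewhere only adds a further point to avoid. *)
pose c n := if @unpickle (nat * nat)%type n is Some ji
            then (rootsR (q ji.1))`_ji.2 else 0.
have [t tc] := real_avoid_seq c.
exists t => j; apply/negP => qt.
have tin : t \in rootsR (q j).
  by rewrite -(roots_on_rootsR (q0 j)) itv_boundlr qt.
have := tc (pickle (j, index t (rootsR (q j)))).
by rewrite /c pickleK /= nth_index ?eqxx.
Qed.

(** Splitting off the last variable loses no coefficient: the one at [m0] reappears in degree
    [m0 ord_max] at the restricted monomial [res m0]. *)
Lemma muni_neq0 (R : nzRingType) n (p : {mpoly R[n.+1]}) : p != 0 -> muni p != 0.
Proof.
move=> p0; have : msupp p != [::] by rewrite msupp_eq0.
case E: (msupp p) => [|m0 s] // _.
have m0in : m0 \in msupp p by rewrite E mem_head.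
pose res (m : 'X_{1..n.+1}) : 'X_{1..n} :=
  [multinom m (widen_ord (leqnSn n) i) | i < n].
apply/eqP => h; move: m0in; rewrite mcoeff_msupp => /negP; apply.
have := congr1 (fun r : {poly {mpoly R[n]}} => (r`_(m0 ord_max))@_(res m0)) h.
rewrite muniE coef_sum raddf_sum /= coef0 mcoeff0.
rewrite (bigD1_seq m0) ?msupp_uniq //=; last by rewrite E mem_head.
rewrite coefZ coefXn eqxx mulr1 mcoeffZ mcoeffX eqxx mulr1 big1 ?addr0 => [->//|m mm0].
rewrite coefZ coefXn; case: eqP => [e1|_]; last by rewrite mulr0 mcoeff0.
rewrite mulr1 mcoeffZ mcoeffX; case: eqP => [e2|_]; last by rewrite mulr0.
case/eqP: mm0; apply/mnmP => i.
case: (unliftP ord_max i) => [j|] -> //.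
have := congr1 (fun m : 'X_{1..n} => m j) e2; rewrite !mnmE.
by congr (m _ = m0 _); apply/val_inj; rewrite /= /bump leqNgt ltn_ord.
Qed.

Definition cons_point (R : Type) n (x : 'I_n -> R) (t : R) (i : 'I_n.+1) : R :=
  oapp x t (unlift ord_max i).

Lemma meval_muni (R : comNzRingType) n (p : {mpoly R[n.+1]}) (x : 'I_n -> R) t :
  (map_poly (meval x) (muni p)).[t] = p.@[cons_point x t].
Proof.
rewrite muniE rmorph_sum horner_sum mevalE; apply: eq_bigr => m _.
rewrite -mul_polyC rmorphM /= map_polyC map_polyXn hornerM hornerC hornerXn /=.
rewrite mevalZ mevalX big_ord_recr /= -mulrA; congr (_ * (_ * _)).
  apply: eq_bigr => i _; rewrite mnmE; congr (_ ^+ _).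
  rewrite /cons_point -[widen_ord _ i](_ : lift ord_max i = _) ?liftK //.
  by apply/val_inj; rewrite /= /bump leqNgt ltn_ord.
by rewrite /cons_point unlift_none.
Qed.

(** Induction on [n]: once the first variables avoid the zeros of all leading coefficients, the
    polynomials in the last variable stay nonzero, and countably many of them have a common
    non-root. *)
Lemma mpoly_avoid (R : realType) n (q : nat -> {mpoly R[n]}) :
  (forall j, q j != 0) -> exists x : 'I_n -> R, forall j, (q j).@[x] != 0.
Proof.
elim: n q => [|n IH] q q0.
  exists (fun => 0) => j; have := q0 j.
  rewrite -msupp_eq0 mevalE; case E: (msupp _) => [|m s] // _.
  have -> : s = [::].
    have := msupp_uniq (q j); rewrite E /=; case: s {E} => [|m' s] //=.
    by rewrite inE (_ : m = m') ?eqxx //; apply/mnmP => -[].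
  by rewrite big_seq1 big_ord0 mulr1 -mcoeff_msupp E mem_head.
have [x hx] : exists x, forall j, (lead_coef (muni (q j))).@[x] != 0.
  by apply: IH => j; rewrite lead_coef_eq0 muni_neq0.
have [t ht] : exists t, forall j, ~~ root (map_poly (meval x) (muni (q j))) t.
  apply: poly_avoid => j; apply/eqP => h; have := hx j.
  by rewrite lead_coefE -coef_map /= h coef0 eqxx.
by exists (cons_point x t) => j; rewrite -meval_muni; exact: ht.
Qed.

Lemma rat_mpoly_enum n : exists q : nat -> {mpoly rat[n]}, forall p, exists j, q j = p.
Proof.
pose g (s : seq (rat * 'X_{1..n})) : {mpoly rat[n]} := \sum_(x <- s) x.1 *: 'X_[x.2].
exists (fun j => oapp g 0 (unpickle j)) => p.
exists (pickle [seq (p@_m, m) | m <- msupp p]).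
by rewrite pickleK /= /g big_map /= -mpolyE.
Qed.

Lemma generic_exists (R : realType) (V : finType) (k : nat) :
  exists p : V -> 'rV[R]_k, generic p.
Proof.
have [q hq] := rat_mpoly_enum #|{: V * 'I_k}|.
(* The enumeration also hits the zero polynomial, which is replaced by 1 to keep the whole family
   nonzero. *)
pose q' j : {mpoly R[#|{: V * 'I_k}|]} :=
  if q j == 0 then 1 else map_mpoly (@ratr R) (q j).
have [x hx] : exists x, forall j, (q' j).@[x] != 0.
  apply: mpoly_avoid => j; rewrite /q'; case: ifPn => [_|]; first exact: oner_neq0.
  apply: contraNneq => h; apply/eqP/mpolyP => m; have := congr1 (mcoeff m) h.
  rewrite mcoeff_map_mpoly !mcoeff0 => /eqP.
  by rewrite fmorph_eq0 => /eqP.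
exists (fun v => \row_j x (enum_rank (v, j))) => r r0.
have [j jr] := hq r; have := hx j.
rewrite /q' jr (negbTE r0); congr (_ != 0); apply: meval_eq => i.
by rewrite /coords mxE -surjective_pairing enum_valK.
Qed.

(** * Independence at one point and at generic points *)

Lemma free_enumP (K : fieldType) (vT : vectType K) (T : finType) (f : T -> vT)
    (F : {set T}) :
  free (map f (enum F)) <->
  forall w : T -> K, \sum_(e in F) w e *: f e = 0 -> forall e, e \in F -> w e = 0.
Proof.
have sz : size (map f (enum F)) = #|F| by rewrite size_map cardE.
have sumE e0 (w : T -> K) : \sum_(e in F) w e *: f e =
    \sum_(i < size (map f (enum F)))
      w (nth e0 (enum F) i) *: (in_tuple (map f (enum F)))`_i.
  rewrite -big_enum (big_nth e0) big_mkord -(size_map f); apply: eq_bigr => i _.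
  by rewrite (nth_map e0) // -(size_map f).
split=> [/(@freeP _ _ _ (in_tuple _)) h w w0 e eF | h].
  rewrite (sumE e) in w0; have ei : (index e (enum F) < size (map f (enum F)))%N.
    by rewrite size_map index_mem mem_enum.
  by have := h _ w0 (Ordinal ei); rewrite /= nth_index ?mem_enum.
apply/(@freeP _ _ _ (in_tuple _)) => k k0 i.
have ilt : (i < size (enum F))%N by have := ltn_ord i; rewrite {2}size_map.
have /card_gt0P [e0 _] : (0 < #|F|)%N by rewrite cardE (leq_ltn_trans _ ilt).
pose w e := oapp k 0 (insub (index e (enum F))).
have wi (j : 'I_(size (map f (enum F)))) : w (nth e0 (enum F) j) = k j.
  have jlt : (j < size (enum F))%N by have := ltn_ord j; rewrite {2}size_map.
  by rewrite /w index_uniq ?enum_uniq // valK.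
rewrite -wi; apply: h; last by rewrite -mem_enum mem_nth.
by rewrite (sumE e0) -[RHS]k0; apply: eq_bigr => j _; rewrite wi.
Qed.

(** If [u] kills the Gram matrix, then [u A A^T u^T = 0] is a vanishing sum of squares, so
    [u A = 0]. Independence thus becomes the nonvanishing of one polynomial in the coordinates. *)
Lemma row_free_gram (R : realFieldType) m n (A : 'M[R]_(m, n)) :
  row_free A = (\det (A *m A^T) != 0).
Proof.
rewrite -unitfE -unitmxE -row_free_unit.
apply/idP/idP => /row_freeP [B AB]; last first.
  by apply/row_freeP; exists (A^T *m B); rewrite mulmxA.
rewrite -kermx_eq0; apply/rowV0P => u /sub_kermxP.
move=> /(congr1 (fun M => M *m u^T)); rewrite mul0mx => uA.
have uA0 : u *m A = 0.
  apply/rowP => j; rewrite mxE; move: uA; rewrite mulmxA -!mulmxA -trmx_mul mulmxA.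
  move=> /matrixP /(_ 0 0); rewrite !mxE => /eqP; rewrite psumr_eq0 => [/allP h|i _].
    by have := h j (mem_index_enum _); rewrite !mxE -expr2 sqrf_eq0 => /eqP ->.
  by rewrite !mxE -expr2 sqr_ge0.
by rewrite -[u]mulmx1 -AB mulmxA uA0 mul0mx.
Qed.

Section Transfer.
Variables (R : realType) (V : finType) (k : nat).
Local Notation n := #|{: V * 'I_k}|.
Implicit Types (p : V -> 'rV[R]_k) (F : {set {set V}}).

Definition rig_mx p F : 'M[R]_(#|F|, n) :=
  \matrix_(i, j) rig_row p (enum_val i) (enum_val j).1 0 (enum_val j).2.

Definition rig_mpoly_mx F : 'M[{mpoly rat[n]}]_(#|F|, n) :=
  \matrix_(i, j) (if (enum_val j).1 \in (enum_val i : {set V}) then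
    \sum_(y in (enum_val i : {set V})) ('X_j - 'X_(enum_rank (y, (enum_val j).2))) else 0).

Definition eval_coords p (q : {mpoly rat[n]}) : R :=
  (map_mpoly (@ratr R) q).@[coords p].

HB.instance Definition _ p := GRing.RMorphism.copy (eval_coords p)
  (meval (coords p) \o map_mpoly (@ratr R)).

Lemma eval_coordsX p i : eval_coords p 'X_i = coords p i.
Proof. by rewrite /eval_coords map_mpolyX mevalXU. Qed.

Lemma rig_mxE p F : rig_mx p F = map_mx (eval_coords p) (rig_mpoly_mx F).
Proof.
apply/matrixP => i j; rewrite !mxE ffunE; case: ifP => _; last by rewrite mxE rmorph0.
rewrite summxE rmorph_sum; apply: eq_bigr => y _.
by rewrite rmorphB /= !eval_coordsX /coords enum_rankK !mxE.
Qed.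

Lemma rig_mx_free p F : row_free (rig_mx p F) <-> free (map (rig_row p) (enum F)).
Proof.
rewrite free_enumP; split => [fr w w0 e eF | h].
  have /row_free_inj inj := fr.
  have : (\row_i w (enum_val i)) *m rig_mx p F = 0.
    apply/rowP => j; rewrite !mxE.
    have := congr1 (fun g : {ffun V -> 'rV[R]_k} => g (enum_val j).1 0 (enum_val j).2) w0.
    rewrite sum_ffunE ffunE mxE summxE.
    move=> e0; rewrite -[RHS]e0 [RHS]big_enum_val /=.
    by apply: eq_bigr => i _; rewrite !mxE !ffunE !mxE.
  rewrite -[RHS](mul0mx _ (rig_mx p F)) => /inj /rowP /(_ (enum_rank_in eF e)).
  by rewrite !mxE enum_rankK_in.
rewrite -kermx_eq0; apply/rowV0P => u /sub_kermxP uM.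
apply/rowP => i; rewrite mxE.
pose w e := \sum_(l | enum_val l == e) u 0 l.
have wE l : w (enum_val l) = u 0 l.
  rewrite /w (eq_bigl (pred1 l)) ?big_pred1_eq // => l'.
  by rewrite (inj_eq enum_val_inj).
rewrite -wE; apply: h; last exact: enum_valP.
apply/ffunP => x; apply/rowP => j; rewrite sum_ffunE !ffunE summxE mxE big_enum_val.
have /rowP /(_ (enum_rank (x, j))) := uM; rewrite !mxE => e0.
by rewrite -[RHS]e0; apply: eq_bigr => l _; rewrite wE !ffunE !mxE enum_rankK ffunE.
Qed.

(** The Gram determinant is a rational polynomial in the coordinates. Being nonzero at [p] it is not
    the zero polynomial, so it is nonzero at the generic [p']. Independence can therefore be checked
    at one convenient framework, however special. *)
Lemma rig_free_generic p p' F : generic p' ->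
  free (map (rig_row p) (enum F)) -> free (map (rig_row p') (enum F)).
Proof.
move=> gp'; rewrite -!rig_mx_free !row_free_gram !rig_mxE !map_trmx -!map_mxM.
rewrite !det_map_mx => h; apply: gp'; apply: contraNneq h => ->.
by rewrite rmorph0.
Qed.

Lemma rig_indepP p F : free (map (rig_row p) (enum F)) -> rig_indep R k F.
Proof. by move=> fr p' gp'; exact: rig_free_generic fr. Qed.

Lemma rig_indep_genericP p F : generic p ->
  rig_indep R k F <-> free (map (rig_row p) (enum F)).
Proof. by move=> gp; split => [|/rig_indepP //]; exact. Qed.

End Transfer.

(** * Circuits of a vector configuration *)

Section VectorCircuits.
Variables (K : fieldType) (vT : vectType K) (T : finType) (f : T -> vT).
Implicit Types (w : T -> K) (C D F : {set T}).

Definition vec_rel w := \sum_e w e *: f e = 0.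
Definition vec_supp w := [set e | w e != 0].
Definition vec_circuit C :=
  ~ free (map f (enum C)) /\ forall D, D \proper C -> free (map f (enum D)).

Lemma vec_rel_sub w w' c : vec_rel w -> vec_rel w' -> vec_rel (fun e => w e - c * w' e).
Proof.
rewrite /vec_rel => h h'; under eq_bigr do rewrite scalerBl -scalerA.
by rewrite sumrB -scaler_sumr h h' scaler0 subr0.
Qed.

Lemma vec_supp_sum w F : vec_supp w \subset F ->
  \sum_(e in F) w e *: f e = \sum_e w e *: f e.
Proof.
move=> /subsetP sF; rewrite big_mkcond; apply: eq_bigr => e _.
case: ifPn => // eF; apply/esym/eqP; rewrite scaler_eq0.
by apply/orP; left; apply: contraNT eF => we; apply: sF; rewrite inE.
Qed.

Lemma vec_freeP F : free (map f (enum F)) <->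
  forall w, vec_rel w -> vec_supp w \subset F -> vec_supp w = set0.
Proof.
rewrite free_enumP; split => h w.
  move=> w0 wF; have := h w; rewrite vec_supp_sum // => /(_ w0) {}h.
  apply/setP => e; rewrite !inE; apply/negbTE; rewrite negbK.
  have [eF|] := boolP (e \in F); first by rewrite h.
  by apply: contraNT => we; apply: (subsetP wF); rewrite inE.
move=> w0 e eF; pose w' e := if e \in F then w e else 0.
have w'F : vec_supp w' \subset F.
  by apply/subsetP => x; rewrite inE /w'; case: ifP => //; rewrite eqxx.
have w'0 : vec_rel w'.
  rewrite /vec_rel -(vec_supp_sum w'F) -[RHS]w0; apply: eq_bigr => x xF.
  by rewrite /w' xF.
have /setP /(_ e) := h _ w'0 w'F.
by rewrite !inE /w' eF => /negbFE /eqP.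
Qed.

Lemma vec_free_sub D F : D \subset F -> free (map f (enum F)) -> free (map f (enum D)).
Proof.
by rewrite !vec_freeP => DF h w w0 wD; apply: h => //; exact: subset_trans DF.
Qed.

Lemma vec_depP F : ~ free (map f (enum F)) ->
  exists w, [/\ vec_rel w, vec_supp w \subset F & vec_supp w != set0].
Proof.
rewrite vec_freeP => nfr; apply: contrapT => h; apply: nfr => w w0 wF.
by apply/eqP; apply: contrapT => /negP ws; apply: h; exists w; split.
Qed.

Lemma vec_circuit_rel C : vec_circuit C -> exists2 w, vec_rel w & vec_supp w = C.
Proof.
move=> [/vec_depP [w [w0 wC wn]] h]; exists w => //; apply/eqP; apply: contraT => wnC.
have /h /vec_freeP fr : vec_supp w \proper C by rewrite properEneq wnC.
by rewrite (fr w) ?eqxx // in wn.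
Qed.

Lemma vec_circuitNsub C D : vec_circuit C -> vec_circuit D -> ~ (D \proper C).
Proof. by move=> [_ hC] [hD _] /hC. Qed.

(** A minimal support [C] of a relation through [e] is a circuit: a relation [v] on a proper subset
    either uses [e], against minimality, or can be subtracted from [w'] to remove some [g] while
    leaving the coefficient of [e] unchanged. *)
Lemma vec_circuit_in w e : vec_rel w -> w e != 0 ->
  exists C, [/\ vec_circuit C, e \in C & C \subset vec_supp w].
Proof.
move=> w0 we.
pose P (S : {set T}) := (e \in S) && `[< exists2 w', vec_rel w' & vec_supp w' = S >].
have Pw : P (vec_supp w) by rewrite /P inE we; apply/asboolP; exists w.
have [C /minsetP [/andP [eC /asboolP [w' w'0 w'C]] minC] Cw] := minset_exists Pw.
exists C; split => //; split.
  by move/vec_freeP => /(_ w' w'0); rewrite w'C => /(_ (subxx _)) C0; rewrite C0 inE in eC.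
move=> D DC; apply: contrapT => /vec_depP [v [v0 vD /set0Pn [g]]].
rewrite inE => vg.
have vC : vec_supp v \subset C by exact: subset_trans vD (proper_sub DC).
have [ve|ve] := boolP (e \in vec_supp v).
  have vE : vec_supp v = C by apply: minC vC; rewrite /P ve; apply/asboolP; exists v.
  by move: DC; rewrite properE -vE vD andbF.
pose u x := w' x - w' g / v g * v x.
have uC : vec_supp u \subset C :\ g.
  apply/subsetP => x; rewrite !inE /u => ux; apply/andP; split.
    by apply: contraNneq ux => ->; rewrite divfK // subrr.
  rewrite -w'C inE; apply: contraNneq ux => w'x.
  rewrite w'x; case: (boolP (x \in vec_supp v)) => [/(subsetP vC)|].
    by rewrite -w'C inE w'x eqxx.
  by rewrite inE negbK => /eqP ->; rewrite mulr0 subrr.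
have gC : g \in C by apply: (subsetP vC); rewrite inE.
have := minC (vec_supp u) _ (subset_trans uC (subsetDl _ _)).
move=> uE; move: uC; rewrite uE; first by move/subsetP => /(_ g gC); rewrite !inE eqxx.
rewrite /P; apply/andP; split; last by apply/asboolP; exists u => //; exact: vec_rel_sub.
move: ve eC; rewrite -w'C !inE negbK /u => /eqP -> w'e.
by rewrite mulr0 subr0.
Qed.

(** Strong circuit elimination: the combination of the two relations that cancels [g] still has [e]
    in its support, because [e] is outside [C2]. *)
Lemma vec_circuit_elim C1 C2 e g : vec_circuit C1 -> vec_circuit C2 ->
    g \in C1 -> g \in C2 -> e \in C1 -> e \notin C2 ->
  exists C, [/\ vec_circuit C, e \in C & C \subset (C1 :|: C2) :\ g].
Proof.
move=> /vec_circuit_rel [w1 w10 <-] /vec_circuit_rel [w2 w20 <-].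
rewrite !inE negbK => g1 g2 e1 /eqP e2.
pose u x := w1 x - w1 g / w2 g * w2 x.
have ue : u e != 0 by rewrite /u e2 mulr0 subr0.
have [C [cC eC Cu]] := vec_circuit_in (vec_rel_sub (w1 g / w2 g) w10 w20) ue.
exists C; split => //; apply: subset_trans Cu _; apply/subsetP => x.
rewrite !inE => ux; apply/andP; split.
  by apply: contraNneq ux => ->; rewrite divfK // subrr.
by rewrite -negb_and; apply: contra ux => /andP [/eqP -> /eqP ->]; rewrite mulr0 subrr.
Qed.

(* Minimizing [#|C1 :|: C2|]: eliminating a common element [x] on both sides gives
   [C3] through [e] and [C4] through [g]; either [C3, C2] or [C3, C4] is a smaller
   intersecting pair. *)
Lemma vec_circuit_trans C1 C2 e g :
    vec_circuit C1 -> vec_circuit C2 -> e \in C1 -> g \in C2 -> C1 :&: C2 != set0 ->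
  exists C, [/\ vec_circuit C, e \in C, g \in C & C \subset C1 :|: C2].
Proof.
have [n] := ubnP #|C1 :|: C2|; elim: n C1 C2 => // n IH C1 C2 lt_n c1 c2 e1 g2 /set0Pn [x].
rewrite inE => /andP [x1 x2].
have [e2|e2] := boolP (e \in C2); first by exists C2; split; rewrite ?subsetUr.
have [g1|g1] := boolP (g \in C1); first by exists C1; split; rewrite ?subsetUl.
have smaller D1 D2 : vec_circuit D1 -> vec_circuit D2 -> e \in D1 -> g \in D2 ->
    D1 :&: D2 != set0 -> D1 :|: D2 \proper C1 :|: C2 ->
    exists C, [/\ vec_circuit C, e \in C, g \in C & C \subset C1 :|: C2].
  move=> d1 d2 eD gD D12 lt.
  have [|C [cC eC gC CD]] := IH D1 D2 _ d1 d2 eD gD D12.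
    by apply: leq_trans (proper_card lt) _; rewrite -ltnS.
  by exists C; split => //; apply: subset_trans CD (proper_sub lt).
have [C3 [c3 e3 s3]] := vec_circuit_elim c1 c2 x1 x2 e1 e2.
have [C4 [c4 g4 s4]] := vec_circuit_elim c2 c1 x2 x1 g2 g1.
rewrite setUC in s4.
have x12 : (C1 :|: C2) :\ x \proper C1 :|: C2 by apply: properD1; rewrite inE x1.
have C32 : C3 :&: C2 != set0.
  apply/eqP => C32; apply: (vec_circuitNsub c1 c3).
  apply: (@sub_proper_trans _ _ (C1 :\ x)); last exact: properD1.
  apply/subsetP => y y3; have := subsetP s3 _ y3; rewrite !inE => /andP [-> /orP[//|y2]].
  by have /setP /(_ y) := C32; rewrite !inE y3 y2.
have [lt|nlt] := boolP (C3 :|: C2 \proper C1 :|: C2); first exact: smaller lt.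
(* If [C3 :|: C2] is not smaller, [C3] contains all of [C1] outside [C2]. The circuit [C4] is not
   inside [C2], so it has an element there, common to [C3] and [C4], while both avoid [x]. *)
have C13 y : y \in C1 -> y \notin C2 -> y \in C3.
  move=> y1 y2; apply: contraNT nlt => y3; apply/properP; split.
    by rewrite subUset subsetUr andbT (subset_trans s3) ?subsetDl.
  by exists y; rewrite !inE ?y1 // negb_or y3.
have [y y4 y2] : exists2 y, y \in C4 & y \notin C2.
  apply/subsetPn; apply/negP => C42; apply: (vec_circuitNsub c2 c4).
  rewrite properE C42; apply/subsetPn; exists x => //.
  by apply/negP => /(subsetP s4); rewrite !inE eqxx.
have y1 : y \in C1.
  by have := subsetP s4 _ y4; rewrite !inE (negbTE y2) orbF => /andP [].
apply: (smaller C3 C4) => //.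
  by apply/set0Pn; exists y; rewrite inE y4 C13.
by apply: sub_proper_trans x12; rewrite subUset s3 s4.
Qed.

End VectorCircuits.

(** * Circuits of the rigidity matroid *)

Section RigCircuits.
Variables (R : realType) (V : finType) (k : nat).
Implicit Types (E F C : {set {set V}}).

Lemma rig_indep_sub E F : F \subset E -> rig_indep R k E -> rig_indep R k F.
Proof. by move=> FE h p gp; apply: vec_free_sub FE (h p gp). Qed.

(** A single generic [p] decides independence of all edge sets at once, so circuit arguments for
    vector configurations apply. *)
Lemma rig_circuitP (p : V -> 'rV[R]_k) E C : generic p ->
  rig_circuit R k E C <-> (C \subset E /\ vec_circuit (rig_row p) C).
Proof.
move=> gp; split => [[CE [h1 h2]]|[CE [h1 h2]]]; split => //; split.
- by move=> /(rig_indep_genericP _ gp).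
- by move=> D /h2 /(rig_indep_genericP _ gp).
- by move=> /(rig_indep_genericP _ gp).
- by move=> D /h2 /(rig_indep_genericP _ gp).
Qed.

Lemma rig_circuit_trans E C1 C2 e g :
    rig_circuit R k E C1 -> rig_circuit R k E C2 -> e \in C1 -> g \in C2 ->
    C1 :&: C2 != set0 ->
  exists C, [/\ rig_circuit R k E C, e \in C & g \in C].
Proof.
have [p gp] := generic_exists R V k.
move=> /(rig_circuitP _ _ gp) [s1 c1] /(rig_circuitP _ _ gp) [s2 c2] e1 g2 C12.
have [C [cC eC gC CC]] := vec_circuit_trans c1 c2 e1 g2 C12.
exists C; split => //; apply/(rig_circuitP _ _ gp); split => //.
by apply: subset_trans CC _; rewrite subUset s1.
Qed.

End RigCircuits.

(** * Stresses as symmetric weights *)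

Section Weights.
Variables (R : realType) (V : finType).
Implicit Types (E F C : {set {set V}}) (a b : V -> V -> R).

(** A stress is encoded on ordered vertex pairs, so that equilibrium at a vertex is a sum over all
    vertices and no edge has to be unpacked. *)
Definition weights E a :=
  (forall x y, a x y = a y x) /\ (forall x y, a x y != 0 -> adj E x y).

Definition equilibrium k (p : V -> 'rV[R]_k) a :=
  forall x, \sum_y a x y *: (p x - p y) = 0.

Lemma simple_sub E F : F \subset E -> simple_graph E -> simple_graph F.
Proof. by move=> /subsetP FE sE e /FE /sE. Qed.

Lemma simple_edge E e x y : simple_graph E -> e \in E -> x \in e -> y \in e ->
  x != y -> e = [set x; y].
Proof.
move=> sE /sE e2 xe ye xy; apply/esym/eqP; rewrite eqEcard e2 cards2 xy andbT.
by rewrite subUset !sub1set xe ye.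
Qed.

Lemma adj_sym E x y : adj E x y = adj E y x.
Proof. by rewrite /adj eq_sym setUC. Qed.

Lemma rig_row_sum k (p : V -> 'rV[R]_k) E (w : {set V} -> R) x : simple_graph E ->
  (\sum_(e in E) w e *: rig_row p e) x =
  \sum_y (if adj E x y then w [set x; y] else 0) *: (p x - p y).
Proof.
move=> sE; rewrite sum_ffunE.
transitivity (\sum_(e in E) \sum_(y in e) (if x \in e then w e else 0) *: (p x - p y)).
  apply: eq_bigr => e _; rewrite !ffunE; case: ifP => _; first by rewrite scaler_sumr.
  by rewrite scaler0 big1 // => y _; rewrite scale0r.
rewrite (exchange_big_dep xpredT) //=; apply: eq_bigr => y _.
have [<-|xy] := eqVneq x y; first by rewrite subrr scaler0 big1 // => e _; rewrite scaler0.
rewrite -scaler_suml; congr (_ *: _); rewrite -big_mkcondr /=.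
have adjE e : [&& e \in E, y \in e & x \in e] = adj E x y && (e == [set x; y]).
  apply/and3P/andP => [[eE ye xe]|[aE /eqP ->]].
    by rewrite /adj xy -(simple_edge sE eE xe ye xy).
  by move: aE; rewrite !inE !eqxx orbT => /andP [].
under eq_bigl do rewrite -andbA adjE.
by case: ifP => _; [rewrite big_pred1_eq | rewrite big_pred0].
Qed.

Lemma rig_freeP k (p : V -> 'rV[R]_k) E : simple_graph E ->
  free (map (rig_row p) (enum E)) <->
  forall a, weights E a -> equilibrium p a -> forall x y, a x y = 0.
Proof.
move=> sE; rewrite free_enumP; split => [h a [a_sym aE] a_eq x y|h w w0 e eE].
  apply/eqP; apply: contraT => axy; have axyE := aE _ _ axy.
  have axx z : a z z = 0 by apply/eqP; apply: contraT => /aE; rewrite /adj eqxx.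
  (* The double sum meets an edge in both orders and the diagonal terms vanish, hence the factor one
     half. *)
  pose w (e : {set V}) := 2^-1 * \sum_(x in e) \sum_(y in e) a x y.
  have wE u v : u != v -> w [set u; v] = a u v.
    move=> uv; have vu : u \notin [set v] by rewrite inE.
    rewrite /w !(big_setU1 _ vu) /= !big_set1 /= !(big_setU1 _ vu) /= !big_set1.
    by rewrite !axx add0r addr0 [a v u]a_sym -mulr2n -[X in _ * X]mulr_natl mulKf // pnatr_eq0.
  have xy : x != y by case/andP: axyE.
  move: (axy); rewrite -wE // h ?eqxx //; last by case/andP: axyE.
  apply/ffunP => z; rewrite rig_row_sum // ffunE -[RHS](a_eq z).
  apply: eq_bigr => v _; congr (_ *: _); case: ifP => [/andP [zv _]|zv]; first exact: wE.
  by apply/esym/eqP; apply: contraFT zv => /aE.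
have /eqP/cards2P [x [y [xy eE2]]] := sE e eE.
pose a u v := if adj E u v then w [set u; v] else 0.
have : a x y = 0.
  apply: h => [|z]; last by rewrite -rig_row_sum // w0 ffunE.
  split => u v; rewrite /a; first by rewrite adj_sym setUC.
  by case: ifP => //; rewrite eqxx.
by rewrite /a /adj xy -eE2 eE.
Qed.

Lemma weights_sub E F a : F \subset E -> weights F a -> weights E a.
Proof.
move=> /subsetP FE [a_sym aF]; split => // x y /aF /andP [xy /FE].
by rewrite /adj xy.
Qed.

Lemma weightsD1 E a x y : weights E a -> a x y = 0 -> weights (E :\ [set x; y]) a.
Proof.
move=> [a_sym aE] axy; split => // u v auv; have /andP [uv uvE] := aE _ _ auv.
rewrite /adj uv !inE uvE andbT; apply: contra_neq uv => uvxy.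
have : u \in [set x; y] by rewrite -uvxy !inE eqxx.
have : v \in [set x; y] by rewrite -uvxy !inE eqxx orbT.
rewrite !inE => /orP [] /eqP ev /orP [] /eqP eu; rewrite ?eu ?ev //.
  by move: auv; rewrite eu ev a_sym axy eqxx.
by move: auv; rewrite eu ev axy eqxx.
Qed.

Lemma weights_lincomb E a b c : weights E a -> weights E b ->
  weights E (fun x y => a x y - c * b x y).
Proof.
move=> [a_sym aE] [b_sym bE]; split => x y; first by rewrite a_sym b_sym.
have [/eqP a0|/aE //] := boolP (a x y == 0).
have [/eqP b0|/bE //] := boolP (b x y == 0).
by rewrite a0 b0 mulr0 subr0 eqxx.
Qed.

Lemma equilibrium_lincomb k (p : V -> 'rV[R]_k) a b c :
  equilibrium p a -> equilibrium p b -> equilibrium p (fun x y => a x y - c * b x y).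
Proof.
move=> ha hb x; under eq_bigr do rewrite scalerBl -scalerA.
by rewrite sumrB -scaler_sumr ha hb scaler0 subr0.
Qed.

(** A stress on [C] that vanishes on one edge lives on the independent set [C] minus that edge, so
    it is zero. This makes [a] nowhere zero on [C], and every other stress on [C] a multiple of
    it. *)
Lemma circuit_weights k (p : V -> 'rV[R]_k) E C : generic p -> simple_graph E ->
    rig_circuit R k E C ->
  exists a, [/\ weights C a, equilibrium p a,
    forall x y, adj C x y -> a x y != 0 &
    forall b x y, weights C b -> equilibrium p b -> adj C x y -> b x y = 0 ->
      forall u v, b u v = 0].
Proof.
move=> gp sE [CE [depC minC]]; have sC := simple_sub CE sE.
have zero b x y : weights C b -> equilibrium p b -> adj C x y -> b x y = 0 ->
    forall u v, b u v = 0.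
  move=> wb eb /andP [_ xyC] bxy.
  have /minC /(rig_indep_genericP _ gp) : C :\ [set x; y] \proper C by exact: properD1.
  move/rig_freeP; apply => //; first exact: simple_sub (subsetDl _ _) sC.
  exact: weightsD1.
have [a [wa ea [x [y axy]]]] :
    exists a, [/\ weights C a, equilibrium p a & exists x y, a x y != 0].
  apply: contrapT => h; apply: depC; apply/(rig_indep_genericP _ gp).
  apply/rig_freeP => // a wa ea x y; apply/eqP; apply: contrapT => /negP axy.
  by apply: h; exists a; split => //; exists x, y.
exists a; split => // u v uv; apply: contra_neq axy => auv.
exact: zero auv _ _.
Qed.

(** The terms for [(x, y)] and [(y, x)] cancel. Consequently equilibrium at all vertices but one,
    later the cone point, gives it at the last one. *)
Lemma equilibrium_total k (p : V -> 'rV[R]_k) a : (forall x y, a x y = a y x) ->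
  \sum_x \sum_y a x y *: (p x - p y) = 0.
Proof.
move=> a_sym; under eq_bigr do under eq_bigr do rewrite scalerBr.
under eq_bigr do rewrite sumrB.
rewrite sumrB [X in _ - X]exchange_big /= -[RHS](subrr (\sum_x \sum_y a x y *: p x)).
by congr (_ - _); apply: eq_bigr => x _; apply: eq_bigr => y _; rewrite a_sym.
Qed.

End Weights.

(** * Cone graphs and their stresses *)

Lemma big_option_sum (M : nmodType) (T : finType) (F : option T -> M) :
  \sum_x F x = F None + \sum_x F (Some x).
Proof.
rewrite (bigD1 None) //=; congr (_ + _).
rewrite (reindex_omap (op := +%R) Some id) => [|[x|] //].
by apply: eq_bigl => x; rewrite eqxx.
Qed.

Section Cone.
Variables (R : realType) (V : finType).
Implicit Types (E F C : {set {set V}}) (A : {set V}).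

(** The apex is joined to [A] only, since the cone over a circuit must not have cone edges at
    vertices that the circuit misses. *)
Definition cone_on C A : {set {set option V}} :=
  ((fun e : {set V} => (@Some V) @: e) @: C) :|: [set [set None; Some u] | u in A].

Lemma cone_onT E : cone_on E setT = cone_edges E.
Proof.
congr (_ :|: _); apply/setP => e.
by apply/imsetP/imsetP => -[u _ ->]; exists u.
Qed.

Lemma imset_Some2 (x y : V) : @Some V @: [set x; y] = [set Some x; Some y].
Proof. by rewrite imsetU1 imset_set1. Qed.

Lemma mem_cone_Some C A (e : {set V}) : ((@Some V @: e) \in cone_on C A) = (e \in C).
Proof.
rewrite inE mem_imset; last by apply: imset_inj => x y [].
case: (e \in C) => //=; apply/imsetP => -[u _ eu].
have : None \in @Some V @: e by rewrite eu !inE eqxx.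
by case/imsetP.
Qed.

Lemma mem_cone_None C A u : ([set None; Some u] \in cone_on C A) = (u \in A).
Proof.
rewrite inE; have -> : [set None; Some u] \in [set (@Some V @: (e : {set V})) | e in C] = false.
  apply/imsetP => -[e _ eu].
  have : None \in @Some V @: e by rewrite -eu !inE eqxx.
  by case/imsetP.
apply/imsetP/idP => [[v vA]|uA]; last by exists u.
by move=> /setP /(_ (Some u)); rewrite !inE eqxx /= => /esym /eqP [->].
Qed.

Lemma adj_cone_SS C A x y : adj (cone_on C A) (Some x) (Some y) = adj C x y.
Proof. by rewrite /adj -imset_Some2 mem_cone_Some. Qed.

Lemma adj_cone_NS C A x : adj (cone_on C A) None (Some x) = (x \in A).
Proof. by rewrite /adj mem_cone_None. Qed.

Lemma adj_cone_SN C A x : adj (cone_on C A) (Some x) None = (x \in A).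
Proof. by rewrite adj_sym adj_cone_NS. Qed.

Lemma adj_cone_NN C A : adj (cone_on C A) None None = false.
Proof. by rewrite /adj eqxx. Qed.

Definition adj_coneE := (adj_cone_SS, adj_cone_NS, adj_cone_SN, adj_cone_NN).

Lemma simple_cone C A : simple_graph C -> simple_graph (cone_on C A).
Proof.
move=> sC e; rewrite inE => /orP [] /imsetP [u uC ->]; last by rewrite cards2.
by rewrite card_imset ?sC // => x y [].
Qed.

Lemma cone_equilibrium d (p : V -> 'rV[R]_d) (q : option V -> 'rV[R]_(1 + d))
    (l : V -> R) (a : option V -> option V -> R) :
    (forall u, q (Some u) - q None = l u *: row_mx 1 (p u)) ->
    (forall u, l u != 0) -> (forall x y, a x y = a y x) ->
  equilibrium q a <->
  equilibrium p (fun u v => a (Some u) (Some v) * (l u * l v)) /\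
  forall u, a (Some u) None * l u = \sum_v a (Some u) (Some v) * (l v - l u).
Proof.
move=> hq l0 a_sym.
pose P u : 'rV[R]_(1 + d) := row_mx 1 (p u).
(* The force at [Some u] is [al u *: P u + row_mx 0 (B u)]. As [P u] has first coordinate 1, it
   vanishes exactly when both [al u] and [B u] do. *)
pose al u := a (Some u) None * l u - \sum_v a (Some u) (Some v) * (l v - l u).
pose B u := \sum_v (a (Some u) (Some v) * l v) *: (p u - p v).
have qq u v : q (Some u) - q (Some v) = (l u - l v) *: P u + l v *: (P u - P v).
  have -> : q (Some u) - q (Some v) = l u *: P u - l v *: P v.
    by rewrite -!hq opprB addrA subrK.
  by rewrite scalerBr addrA -scalerDl subrK.
have PP u v : P u - P v = row_mx 0 (p u - p v).
  by rewrite /P opp_row_mx add_row_mx subrr.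
have SE u : \sum_y a (Some u) y *: (q (Some u) - q y) =
    row_mx (al u)%:M (al u *: p u + B u).
  rewrite big_option_sum hq.
  transitivity (al u *: P u + row_mx 0 (B u)).
    rewrite /al scalerBl scalerA -addrA; congr (_ + _).
    under eq_bigr do rewrite qq scalerDr !scalerA PP.
    rewrite big_split /= -scaler_suml -scaleNr -sumrN; congr (_ *: _ + _).
      by apply: eq_bigr => v _; rewrite -mulrN opprB.
    rewrite /B; apply: (big_rec2 (fun x y => x = row_mx 0 y)) => [|v _ y _ ->].
      by rewrite row_mx0.
    by rewrite scale_row_mx scaler0 add_row_mx add0r.
  by rewrite /P scale_row_mx add_row_mx addr0 scalemx1.
have S0 u : \sum_y a (Some u) y *: (q (Some u) - q y) = 0 <-> al u = 0 /\ B u = 0.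
  rewrite SE; split => [|[-> ->]]; last first.
    by rewrite scale0r addr0 raddf0 row_mx0.
  rewrite -[RHS]row_mx0 => /eq_row_mx [/matrixP /(_ 0 0)].
  by rewrite !mxE eqxx mulr1n => ->; rewrite scale0r add0r.
have Bl u : \sum_v (a (Some u) (Some v) * (l u * l v)) *: (p u - p v) = l u *: B u.
  by rewrite /B scaler_sumr; apply: eq_bigr => v _; rewrite scalerA mulrCA.
split => [e|[e1 e2] x].
  split => u; have /S0 [al0 B0] := e (Some u); last first.
    by apply/eqP; rewrite -subr_eq0 -/(al u) al0.
  by rewrite Bl B0 scaler0.
have Su u : \sum_y a (Some u) y *: (q (Some u) - q y) = 0.
  apply/S0; split; first by rewrite /al e2 subrr.
  by have /eqP := e1 u; rewrite Bl scaler_eq0 (negbTE (l0 u)) => /eqP.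
case: x => [u|] //; have := equilibrium_total q a_sym.
by rewrite big_option_sum [X in _ + X]big1 ?addr0.
Qed.

End Cone.

(** * Coning *)

Section Coning.
Variables (R : realType) (V : finType) (d : nat).
Implicit Types (E F C : {set {set V}}) (A : {set V}).

Lemma cone_weights_eq0 C A (a : option V -> option V -> R) :
    weights (cone_on C A) a -> (forall u v, a (Some u) (Some v) = 0) ->
    (forall u, a (Some u) None = 0) ->
  forall x y, a x y = 0.
Proof.
move=> [a_sym aE] a1 a2 [u|] [v|] //; first by rewrite a_sym.
by apply/eqP; apply: contraT => /aE; rewrite /adj eqxx.
Qed.

Lemma cone_weights_base C A (a : option V -> option V -> R) (l : V -> R) :
    weights (cone_on C A) a ->
  weights C (fun u v => a (Some u) (Some v) * (l u * l v)).
Proof.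
move=> [a_sym aE]; split => u v; first by rewrite a_sym [l u * _]mulrC.
by rewrite mulf_eq0 negb_or => /andP [/aE]; rewrite adj_coneE.
Qed.

(** All heights are 1 and the apex is the origin: a stress of the cone is zero on [C] by
    independence, and then on each cone edge by equilibrium at its lower end. *)
Lemma rig_indep_cone C A : simple_graph C ->
  rig_indep R d C -> rig_indep R d.+1 (cone_on C A).
Proof.
move=> sC iC; have [p gp] := generic_exists R V d.
pose q x : 'rV[R]_(1 + d) := if x is Some u then row_mx 1 (p u) else 0.
apply: (@rig_indepP _ _ _ q); apply/rig_freeP; first exact: simple_cone.
move=> a wa /(@cone_equilibrium _ _ _ p q (fun=> 1)) [].
- by move=> u; rewrite scale1r subr0.
- by move=> u; exact: oner_neq0.
- by case: wa.
move=> e1 e2; have /rig_freeP z := iC p gp.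
have a0 u v : a (Some u) (Some v) = 0.
  by rewrite -[LHS]mulr1 -[X in _ * X]mulr1 (z sC _ (cone_weights_base _ wa) e1).
apply: (cone_weights_eq0 wa a0) => u; rewrite -[LHS]mulr1 e2 big1 // => v _.
by rewrite a0 mul0r.
Qed.

Lemma generic_coord_neq (W : finType) k (q : W -> 'rV[R]_k) x y j :
  generic q -> x != y -> q x 0 j != q y 0 j.
Proof.
move=> gq xy; rewrite -subr_eq0.
have := gq ('X_(enum_rank (x, j)) - 'X_(enum_rank (y, j))).
rewrite rmorphB rmorphB /= !map_mpolyX !mevalXU /coords !enum_rankK; apply.
rewrite subr_eq0; apply/negP => /eqP /(congr1 (mcoeff U_(enum_rank (x, j)))).
rewrite !mcoeffX eqxx eq_mnm1 => /eqP; rewrite (inj_eq enum_rank_inj) xpair_eqE.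
by rewrite [y == x]eq_sym (negbTE xy) oner_eq0.
Qed.

(** Central projection of a generic [q] from the apex gives [p], the heights being nonzero by
    genericity. A stress of [p] lifts to one of [q], which must vanish; the condition on [A] keeps
    the lift on available cone edges. *)
Lemma rig_indep_cone_base C A : simple_graph C ->
    (forall x y, adj C x y -> x \in A) ->
  rig_indep R d.+1 (cone_on C A) -> rig_indep R d C.
Proof.
move=> sC CA iC; have [q gq] := generic_exists R (option V) d.+1.
pose q' : option V -> 'rV[R]_(1 + d) := q.
pose l u := lsubmx (q' (Some u) - q' None) 0 0.
have l0 u : l u != 0.
  rewrite /l !mxE subr_eq0; exact: generic_coord_neq.
pose p u := (l u)^-1 *: rsubmx (q' (Some u) - q' None).
have hq u : q' (Some u) - q' None = l u *: row_mx 1 (p u).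
  rewrite scale_row_mx scalerA divff // scale1r -[LHS]hsubmxK; congr row_mx.
  by rewrite [LHS]mx11_scalar -scalemx1.
have /rig_freeP z := iC q gq.
apply: (@rig_indepP _ _ _ p); apply/rig_freeP => // b [b_sym bC] eb u v.
pose a x y : R := match x, y with
  | Some u, Some v => b u v / (l u * l v)
  | Some u, None | None, Some u => (\sum_v b u v / (l u * l v) * (l v - l u)) / l u
  | None, None => 0 end.
have wa : weights (cone_on C A) a.
  split => -[x|] [y|] //=; rewrite ?eqxx ?adj_coneE //.
  - by rewrite b_sym [l x * _]mulrC.
  - by rewrite mulf_eq0 negb_or => /andP [/bC].
  - apply: contra_neqT => xA; rewrite big1 ?mul0r // => y _.
    have [->|/bC/CA] := eqVneq (b x y) 0; first by rewrite !mul0r.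
    by rewrite (negbTE xA).
  - apply: contra_neqT => xA; rewrite big1 ?mul0r // => x _.
    have [->|/bC/CA] := eqVneq (b y x) 0; first by rewrite !mul0r.
    by rewrite (negbTE xA).
have ea : equilibrium q a.
  apply/(cone_equilibrium hq l0 (proj1 wa)); split => [x|x].
    rewrite -[RHS](eb x); apply: eq_bigr => y _.
    by rewrite /= divfK // mulf_neq0.
  by rewrite /= divfK.
have := z (simple_cone sC) _ wa ea (Some u) (Some v).
by move=> /eqP; rewrite /= mulf_eq0 invr_eq0 mulf_eq0 !(negbTE (l0 _)) !orbF => /eqP.
Qed.

Lemma cover_adj C u : simple_graph C -> u \in cover C -> exists v, adj C u v.
Proof.
move=> sC /bigcupP [e eC ue]; have /eqP/cards2P [x [y [xy eE]]] := sC e eC.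
move: ue; rewrite eE !inE => /orP [] /eqP ->; [exists y|exists x].
  by rewrite /adj xy -eE.
by rewrite adj_sym /adj xy -eE.
Qed.

Lemma adj_cover C x y : adj C x y -> x \in cover C.
Proof. by move=> /andP [_ xyC]; apply/bigcupP; exists [set x; y]; rewrite ?inE ?eqxx. Qed.

(* Points [mu u = t ^ rank u] on the moment curve avoid the finitely many
   hyperplanes [\sum_v a u v * (mu u - mu v) = 0]. *)
Lemma cone_heights C (a : V -> V -> R) : simple_graph C ->
    (forall x y, adj C x y -> a x y != 0) ->
  exists mu : V -> R, (forall u, mu u != 0) /\
    forall u, u \in cover C -> \sum_v a u v * (mu u - mu v) != 0.
Proof.
move=> sC a0; pose X (u : V) : {poly R} := 'X^(enum_rank u).
pose L u := \sum_v a u v *: (X u - X v).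
have L0 u : u \in cover C -> L u != 0.
  (* For a neighbour [v] of [u], the coefficient of [L u] in degree [enum_rank v] is [- a u v]. *)
  move=> /(cover_adj sC) [v uv]; apply/eqP => /(congr1 (fun P : {poly R} => P`_(enum_rank v))).
  have vu : v == u = false by move: uv => /andP [/negbTE uv _]; rewrite eq_sym.
  rewrite coef0 coef_sum (bigD1 v) //= coefZ coefB !coefXn eqxx.
  rewrite big1 => [|w wv]; last first.
    rewrite coefZ coefB !coefXn !(inj_eq val_inj) !(inj_eq enum_rank_inj) vu.
    by rewrite eq_sym (negbTE wv) subrr mulr0.
  rewrite !(inj_eq val_inj) !(inj_eq enum_rank_inj) vu addr0 sub0r mulrN1 => /eqP.
  by rewrite oppr_eq0; apply/negP/a0.
(* The factor ['X] forces [t != 0], hence nonzero heights. *)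
have [|t ht] := @poly_avoid R (fun=> 'X * \prod_(u in cover C) L u).
  by move=> _; rewrite mulf_neq0 ?polyX_eq0 //; apply/prodf_neq0.
have {ht} := ht 0%N; rewrite rootM negb_or rootX => /andP [t0 ht].
exists (fun u => t ^+ enum_rank u); split => [u|u uC]; first by rewrite expf_neq0.
move: ht; rewrite rootE horner_prod => /prodf_neq0 /(_ u uC).
congr (_ != 0); rewrite horner_sum; apply: eq_bigr => v _.
by rewrite hornerZ hornerD hornerN !hornerXn.
Qed.

(** Deleting any edge [f] must leave an independent set. For [f] above an edge of [C], the induced
    stress on [C] vanishes on an edge, hence everywhere. For [f] a cone edge at [u], the induced
    stress is [c] times [a0], and the choice of heights forces [c = 0]. *)
Lemma rig_circuit_cone E C : simple_graph E -> rig_circuit R d E C ->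
  rig_circuit R d.+1 (cone_edges E) (cone_on C (cover C)).
Proof.
move=> sE cC; have [CE [depC minC]] := cC; have sC := simple_sub CE sE.
have [p gp] := generic_exists R V d.
have [a0 [wa0 ea0 a0n a0zero]] := circuit_weights gp sE cC.
split; last split.
- rewrite -cone_onT; apply: setUSS; first exact: imsetS.
  by apply: imsetS; exact: subsetT.
- by move=> h; apply: depC; apply: rig_indep_cone_base h => // x y; exact: adj_cover.
move=> D /properP [DC [f fC fD]].
have DCf : D \subset cone_on C (cover C) :\ f by rewrite subsetD1 DC fD.
apply: rig_indep_sub DCf _.
have [mu [mu0 muC]] := cone_heights sC a0n.
(* With reciprocal heights, [a (Some u) (Some v) * (l v - l u)] equals [b u v * (mu u - mu v)], the
   expression controlled by [cone_heights]. *)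
pose l u := (mu u)^-1; have l0 u : l u != 0 by rewrite invr_eq0.
pose q x : 'rV[R]_(1 + d) := if x is Some u then l u *: row_mx 1 (p u) else 0.
have hq u : q (Some u) - q None = l u *: row_mx 1 (p u) by rewrite subr0.
apply: (@rig_indepP _ _ _ q); apply/rig_freeP.
  by apply: simple_sub (subsetDl _ _) _; exact: simple_cone.
move=> a wf; have wa := weights_sub (subsetDl _ _) wf.
move=> /(cone_equilibrium hq l0 (proj1 wa)) [eb ev].
pose b u v := a (Some u) (Some v) * (l u * l v).
have wb : weights C b := cone_weights_base l wa.
have b0 : forall u v, b u v = 0.
  move: fC; rewrite inE => /orP [] /imsetP [].
    move=> e eC fe; have /eqP/cards2P [x [y [xy eE]]] := sC e eC.
    apply: (a0zero b x y) => //; first by rewrite /adj xy -eE.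
    rewrite /b (_ : a _ _ = 0) ?mul0r //; apply/eqP; apply: contraT => /(proj2 wf).
    by rewrite /adj -imset_Some2 -eE -fe !inE eqxx andbF.
  move=> u uC fu; have [v uv] := cover_adj sC uC.
  pose c := b u v / a0 u v.
  have bc x y : b x y = c * a0 x y.
    apply/eqP; rewrite -subr_eq0; apply/eqP.
    apply: (a0zero (fun x y => b x y - c * a0 x y) u v) => //.
    - exact: weights_lincomb.
    - exact: equilibrium_lincomb.
    by rewrite divfK ?subrr ?a0n.
  suff c0 : c = 0 by move=> x y; rewrite bc c0 mul0r.
  have au : a (Some u) None = 0.
    apply/eqP; apply: contraT => /(proj2 wf).
    by rewrite adj_sym /adj -fu !inE eqxx.
  have := ev u; rewrite au mul0r => /esym /eqP.
  rewrite (_ : \sum_v _ = c * \sum_v a0 u v * (mu u - mu v)).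
    by rewrite mulf_eq0 (negbTE (muC u uC)) orbF => /eqP.
  rewrite mulr_sumr; apply: eq_bigr => w _; rewrite mulrA -bc /b -!mulrA.
  by congr (_ * _); rewrite !mulrBr /l (mulVf (mu0 w)) mulr1 mulrCA (mulVf (mu0 u)) mulr1.
have a00 u v : a (Some u) (Some v) = 0.
  by have /eqP := b0 u v; rewrite !mulf_eq0 !(negbTE (l0 _)) !orbF => /eqP.
apply: (cone_weights_eq0 wa a00) => u.
have /eqP := ev u; rewrite big1 => [|v _]; last by rewrite a00 mul0r.
by rewrite mulf_eq0 (negbTE (l0 u)) orbF => /eqP.
Qed.

End Coning.

(** * Ranks and bridges *)

Section Rank.
Variables (R : realType) (V : finType) (k : nat).
Implicit Types (E F S : {set {set V}}) (e : {set V}).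

Lemma rig_indep0 : rig_indep R k (set0 : {set {set V}}).
Proof. by move=> p _; rewrite enum_set0 nil_free. Qed.

Lemma rig_rank_ge S F : S \subset F -> rig_indep R k S -> (#|S| <= rig_rank R k F)%N.
Proof. by move=> SF iS; apply: leq_bigmax_cond; rewrite SF; apply/asboolP. Qed.

Lemma rig_rank_attained F :
  exists S, [/\ S \subset F, rig_indep R k S & #|S| = rig_rank R k F].
Proof.
pose P := [pred S : {set {set V}} | (S \subset F) && `[< rig_indep R k S >]].
have : (0 < #|P|)%N.
  by apply/card_gt0P; exists set0; rewrite inE sub0set; apply/asboolP/rig_indep0.
move=> /(eq_bigmax_cond (fun S : {set {set V}} => #|S|)) [S /andP [SF /asboolP iS] rS].
by exists S; split.
Qed.

(** Let [S] be a basis of [E :\ e]. If adding [e] kept it independent, the rank would drop on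
    deleting [e]; so [e |: S] is dependent, and a minimal dependent subset has to contain [e]. *)
Lemma circuit_of_not_bridge E e : e \in E -> ~ M_bridge R k E e ->
  exists2 C, rig_circuit R k E C & e \in C.
Proof.
move=> eE nb; have [S [SE iS rS]] := rig_rank_attained (E :\ e).
have SeE : e |: S \subset E.
  by rewrite subUset sub1set eE (subset_trans SE) ?subsetDl.
have eS : e \notin S by apply/negP => /(subsetP SE); rewrite !inE eqxx.
have dep : ~ rig_indep R k (e |: S).
  move=> /(rig_rank_ge SeE); rewrite cardsU1 eS add1n rS => ge1.
  apply: nb; split => //; apply/eqP; rewrite eqn_leq; apply/andP; split.
    by rewrite -ltnS prednK // (leq_trans _ ge1).
  (* Conversely, deletion of [e] lowers the rank by at most one: remove [e] from a basis of [E]. *)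
  rewrite -subn1 leq_subLR; have [B [BE iB <-]] := rig_rank_attained E.
  have := @rig_rank_ge (B :\ e) (E :\ e) (setSD _ BE) (rig_indep_sub (subsetDl _ _) iB).
  by rewrite (cardsD1 e B); apply: leq_add; exact: leq_b1.
pose P S' := ~~ `[< rig_indep R k S' >].
have PS : P (e |: S) by apply/asboolPn.
have [C /minsetP [/asboolPn nC minC] CS] := minset_exists PS.
exists C; last first.
  apply: contraT => eC; case: nC; apply: rig_indep_sub iS; apply/subsetP => g gC.
  by have := subsetP CS _ gC; rewrite !inE => /orP [/eqP ge|//]; rewrite -ge gC in eC.
split; first exact: subset_trans CS SeE.
split => // D DC; apply: contrapT => nD.
have := minC D _ (proper_sub DC); rewrite /P => E1; move: DC; rewrite E1 ?properxx //.
exact/asboolPn.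
Qed.

Lemma bridge_basis E e : rig_indep R k [set e] -> M_bridge R k E e ->
  exists B : {set {set V}}, [/\ B \subset E :\ e, rig_indep R k (e |: B) &
    forall g, g \in E :\ e -> g \notin B -> ~ rig_indep R k (g |: B)].
Proof.
move=> ie [eE rE]; have [S [SE iS rS]] := rig_rank_attained E.
(* The predecessor is truncated at 0, so a positive rank is what makes the bridge equation a genuine
   drop. *)
have E0 : (0 < rig_rank R k E)%N.
  by apply: leq_trans (rig_rank_ge _ ie); rewrite ?cards1 ?sub1set.
have eS : e \in S.
  apply: contraT => eS; have := @rig_rank_ge S (E :\ e); rewrite rE rS subsetD1 SE eS.
  by move=> /(_ isT iS); rewrite leqNgt ltn_predL E0.
exists (S :\ e); split; [exact: setSD | by rewrite setD1K |].
move=> g gE gS ig; have := @rig_rank_ge (g |: S :\ e) (E :\ e) _ ig.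
rewrite subUset sub1set gE setSD // => /(_ isT).
by rewrite cardsU1 gS rE -rS (cardsD1 e S) eS !add1n ltnn.
Qed.

End Rank.

Lemma free_setU1 (K : fieldType) (vT : vectType K) (T : finType) (f : T -> vT)
    (S : {set T}) (g : T) : g \notin S ->
  free (map f (enum (g |: S))) =
  (f g \notin <<map f (enum S)>>%VS) && free (map f (enum S)).
Proof.
move=> gS; rewrite -free_cons -map_cons; apply/perm_free/perm_map/uniq_perm.
- exact: enum_uniq.
- by rewrite /= mem_enum gS enum_uniq.
by move=> x; rewrite !inE !mem_enum !inE.
Qed.

(** * The equivalence *)

Section Main.
Variables (R : realType) (V : finType) (d : nat).
Implicit Types (E : {set {set V}}).

(** If [x] and [y] lay in different components, a circuit through both cone edges would carry a
    stress whose part above the component of [x] is again a stress. It is zero at the edge to [y]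
    but not at the edge to [x], which a circuit forbids. *)
Lemma cone_connected E : simple_graph E ->
  M_connected R d.+1 (cone_edges E) -> graph_connected E.
Proof.
move=> sE; rewrite -cone_onT => mc x y; apply: contraT => nxy.
have sT := simple_cone (A := setT) sE.
have [|||C [cC [xC yC]]] := mc [set None; Some x] [set None; Some y].
- by rewrite mem_cone_None inE.
- by rewrite mem_cone_None inE.
- apply: contraNneq (nxy) => /setP /(_ (Some x)); rewrite !inE eqxx /=.
  by move=> /esym /eqP [->]; rewrite connect0.
have [q gq] := generic_exists R (option V) d.+1.
have [a [[a_sym aC] ea an az]] := circuit_weights gq sT cC.
pose S (s : option V) := if s is Some z then connect (adj E) x z else false.
pose a' s t := if S s || S t then a s t else 0.
have adj_S z w : a (Some z) (Some w) != 0 -> S (Some w) -> S (Some z).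
  move=> /aC; rewrite /adj => /andP [zw zwC] Sw.
  have : adj (cone_on E setT) (Some z) (Some w).
    by rewrite /adj zw (subsetP (proj1 cC)).
  rewrite adj_coneE adj_sym => wz; apply: connect_trans Sw _; exact: connect1.
have a'_sym s t : a' s t = a' t s by rewrite /a' orbC a_sym.
have ea' : equilibrium q a'.
  have eS z : \sum_t a' (Some z) t *: (q (Some z) - q t) = 0.
    have [Sz|nSz] := boolP (S (Some z)).
      by rewrite -[RHS](ea (Some z)); apply: eq_bigr => t _; rewrite /a' Sz.
    apply: big1 => t _; rewrite /a' (negbTE nSz) /=; case: ifP => [St|_]; last exact: scale0r.
    case: t St => // w Sw; rewrite (_ : a _ _ = 0) ?scale0r //.
    by apply/eqP; apply: contraNT nSz => zw; exact: adj_S zw Sw.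
  case=> [z|]; first exact: eS.
  by have := equilibrium_total q a'_sym; rewrite big_option_sum [X in _ + X]big1 ?addr0.
have wa' : weights C a'.
  by split => // s t; rewrite /a'; case: ifP => [_ /aC|] //; rewrite eqxx.
have yA : adj C None (Some y) by rewrite /adj.
have := az a' None (Some y) wa' ea' yA _ None (Some x).
rewrite /a' /= (negbTE nxy) connect0 => /(_ erefl) /eqP; apply: contraTT => _.
by apply: an; rewrite /adj.
Qed.

(** In positive dimension, generic end points differ already in their first coordinate, so the row
    of [e] is nonzero. *)
Lemma rig_indep1 E e : (0 < d)%N -> simple_graph E -> e \in E ->
  rig_indep R d [set e].
Proof.
move=> d0 sE eE; have se : simple_graph [set e] by move=> g /set1P ->; exact: sE.
move=> p gp; apply/rig_freeP => // a [a_sym ae] ea x y.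
apply/eqP; apply: contraT => axy; have := ea x.
rewrite (bigD1 y) //= big1 => [|z zy]; last first.
  rewrite (_ : a x z = 0) ?scale0r //; apply/eqP; apply: contraNT zy => axz.
  have := ae _ _ axy; have := ae _ _ axz; rewrite /adj !inE.
  move=> /andP [xz /eqP exz] /andP [xy /eqP exy].
  have : z \in [set x; y] by rewrite exy -exz !inE eqxx orbT.
  by rewrite !inE eq_sym (negbTE xz).
rewrite addr0 => /eqP; rewrite scaler_eq0 (negbTE axy) subr_eq0 /= => /eqP pxy.
have /andP [xy _] := ae _ _ axy.
by have := generic_coord_neq (Ordinal d0) gp xy; rewrite pxy eqxx.
Qed.

(** For a bridge [e], a basis [B] of [E :\ e] stays independent with [e] added. The cone over [B]
    spans all other rows of the cone over [E], so a circuit through [e] would put the row of [e] in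
    that span, although the cone over [e |: B] is independent. *)
Lemma cone_no_bridge E e : (0 < d)%N -> simple_graph E ->
  M_connected R d.+1 (cone_edges E) -> ~ M_bridge R d E e.
Proof.
move=> d0 sE; rewrite -cone_onT => mc be; have eE := proj1 be.
have [B [BE ieB maxB]] := bridge_basis (rig_indep1 d0 sE eE) be.
have sB : simple_graph (e |: B).
  by apply: simple_sub sE; rewrite subUset sub1set eE (subset_trans BE) ?subsetDl.
have eB : e \notin B by apply/negP => /(subsetP BE); rewrite !inE eqxx.
have cone_setU1 g S : cone_on (g |: S) setT = (@Some V @: (g : {set V})) |: cone_on S setT.
  by rewrite /cone_on imsetU1 setUA.
(* [M_connected] yields a circuit only from two distinct edges; a cone edge at an end of [e] serves
   as the second. *)
have [u ue] : exists u, u \in e by apply/card_gt0P; rewrite sE.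
have [|||C [[CE cC] [eC uC]]] := mc (@Some V @: e) [set None; Some u].
- by rewrite mem_cone_Some.
- by rewrite mem_cone_None inE.
- apply/eqP => /setP /(_ None); rewrite !inE eqxx /=.
  by apply/negP/imsetP => -[].
have [q gq] := generic_exists R (option V) d.+1.
have {}cC : vec_circuit (rig_row q) C.
  by apply: (proj2 (proj1 (rig_circuitP (cone_on E setT) C gq) _)).
have [w w0 wC] := vec_circuit_rel cC.
set U := <<map (rig_row q) (enum (cone_on B setT))>>%VS.
have fB : free (map (rig_row q) (enum (cone_on B setT))).
  apply/(rig_indep_genericP _ gq)/rig_indep_cone; first exact: simple_sub (subsetUr _ _) sB.
  exact: rig_indep_sub (subsetUr _ _) ieB.
have UB g : g \in cone_on B setT -> rig_row q g \in U.
  by move=> gB; apply: memv_span; apply: map_f; rewrite mem_enum.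
have US g : g \in C -> g != @Some V @: e -> rig_row q g \in U.
  move=> /(subsetP CE) gE ge; have [/UB //|gB] := boolP (g \in cone_on B setT).
  move: gE gB ge; rewrite [in X in X -> _]inE => /orP [] /imsetP [g0 g0E ->]; last first.
    by rewrite mem_cone_None inE.
  rewrite mem_cone_Some => g0B g0e.
  have g0Ee : g0 \in E :\ e.
    by rewrite !inE g0E andbT; apply: contra_neq g0e => ->.
  (* A row outside the span would make the cone over [g0 |: B] independent, hence [g0 |: B] itself,
     against maximality of [B]. *)
  apply: contraT => nU; case: (maxB g0 g0Ee g0B).
  apply: (@rig_indep_cone_base _ _ _ _ setT) => [|x y _|]; last 1 first.
  - apply/(rig_indep_genericP _ gq); rewrite cone_setU1 free_setU1 ?mem_cone_Some //.
    by rewrite nU.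
  - apply: simple_sub sE; rewrite subUset sub1set g0E (subset_trans BE) ?subsetDl //.
  - by rewrite inE.
have : free (map (rig_row q) (enum (cone_on (e |: B) setT))).
  by apply/(rig_indep_genericP _ gq)/rig_indep_cone.
rewrite cone_setU1 free_setU1 ?mem_cone_Some // => /andP [/negP nU _]; apply: nU; rewrite -/U.
have we : w (@Some V @: e) != 0 by move: eC; rewrite -wC inE.
have := rpredZeq U (w (@Some V @: e)) (rig_row q (@Some V @: e)).
rewrite (negbTE we) /= => <-; have := w0; rewrite /vec_rel (bigD1 (@Some V @: e)) //=.
move=> /eqP; rewrite addr_eq0 => /eqP ->; rewrite rpredN; apply: rpred_sum => g ge.
have [/US/(_ ge)|] := boolP (g \in C); first exact: rpredZ.
by rewrite -wC inE negbK => /eqP ->; rewrite scale0r rpred0.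
Qed.

Lemma cone_M_connected E : simple_graph E -> graph_connected E ->
  (forall e, ~ M_bridge R d E e) -> M_connected R d.+1 (cone_edges E).
Proof.
move=> sE cE nb; pose r x : {set option V} := [set None; Some x].
(* Equality is allowed because [M_connected] speaks of distinct edges only; with it the relation is
   reflexive and walks of length zero need no circuit. *)
pose linked (e f : {set option V}) := e = f \/
  exists2 C, rig_circuit R d.+1 (cone_edges E) C & (e \in C) && (f \in C).
have linkedC e f : linked e f -> linked f e.
  by move=> [->|[C cC]]; [left | rewrite andbC => h; right; exists C].
have linked_trans e f g : linked e f -> linked f g -> linked e g.
  move=> [->//|[C cC /andP [eC fC]]] [<-|[D cD /andP [fD gD]]]; right.
    by exists C => //; rewrite eC.
  have [|C' [cC' eC' gC']] := rig_circuit_trans cC cD eC gD.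
    by apply/set0Pn; exists f; rewrite inE fC.
  by exists C' => //; rewrite eC'.
have link_edge x y : adj E x y -> linked (r x) (r y) /\ linked (@Some V @: [set x; y]) (r x).
  move=> /andP [xy xyE]; have [C cC xyC] := circuit_of_not_bridge xyE (nb _).
  have cD := rig_circuit_cone sE cC.
  have xC z : z \in [set x; y] -> r z \in cone_on C (cover C).
    by move=> zxy; rewrite mem_cone_None; apply/bigcupP; exists [set x; y].
  split; right; exists (cone_on C (cover C)) => //; rewrite ?mem_cone_Some ?xyC.
    by rewrite !xC // !inE eqxx ?orbT.
  by rewrite xC // !inE eqxx.
have link_vertices x y : linked (r x) (r y).
  have /connectP [s] := cE x y; elim: s x => [|z s IH] x /=; first by move=> _ ->; left.
  move=> /andP [/link_edge [xz _] /IH h] /h; exact: linked_trans xz.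
have link_r e : e \in cone_edges E -> exists x, linked e (r x).
  rewrite inE => /orP [] /imsetP [x xE ->]; last by exists x; left.
  have /eqP/cards2P [u [v [uv xuv]]] := sE x xE.
  by exists u; rewrite xuv; apply: (link_edge u v _).2; rewrite /adj uv -xuv.
move=> e f /link_r [x ex] /link_r [y fy] ef.
have [eqef|[C cC /andP [eC fC]]] : linked e f.
  exact: linked_trans ex (linked_trans _ _ _ (link_vertices x y) (linkedC _ _ fy)).
- by rewrite eqef eqxx in ef.
- by exists C.
Qed.

End Main.

Theorem theorem5p3 (R : realType) (d : nat) (V : finType) (E : {set {set V}}) :
  (1 <= d)%N -> simple_graph E ->
  (M_connected R d.+1 (cone_edges E) <->
   (graph_connected E /\ (forall e, ~ M_bridge R d E e))).
Proof.
move=> d1 sE; split => [mc|[cE nb]]; last exact: cone_M_connected.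
by split => [|e]; [exact: cone_connected mc | exact: cone_no_bridge mc].
Qed.
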